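(* Let $T\subsetneq S$ be local orders in a simple Artinian ring $Q$ with the same prime ideals. Then $T$ is a right Mori order if and only if $S$ is a right Mori order.
   Context: An order $S$ in a simple Artinian ring $Q$ is a prime Goldie ring with total quotient ring $Q$; $U(Q)$ is the group of units of $Q$. An order $S$ is local if its Jacobson radical $J(S)$ is the only maximal right (left) ideal of $S$. ''With the same prime ideals'' means that the set of prime ideals of $T$ and the set of prime ideals of $S$ coincide as sets of subsets of $Q$. For a right $S$-submodule $I$ of $Q$ put $(S:I)_l=\{q\in Q: qI\subseteq S\}$, and for a left $S$-submodule $J$ put $(S:J)_r=\{q\in Q: Jq\subseteq S\}$; put $I^{\nu}=(S:(S:I)_l)_r$. A right $S$-ideal is a right $S$-submodule $I$ of $Q$ that is regular (contains a regular element of $S$) and satisfies $uI\subseteq S$ for some $u\in U(Q)$; it is integral if $I\subseteq S$, and right divisorial if $I^{\nu}=I$. $S$ is a right Mori order if it satisfies the ascending chain condition on regular integral right divisorial right ideals. The same definitions apply with $T$ in place of $S$. *)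

(* Defs.v *)
From HB Require Import structures.
From mathcomp Require Import all_boot all_order all_algebra.
From mathcomp Require Import all_classical.
Set Implicit Arguments.
Unset Strict Implicit.
Unset Printing Implicit Defensive.
Import GRing.Theory.
Local Open Scope classical_set_scope.
Local Open Scope ring_scope.

(* Subrings of [Q] and their one-sided ideals are sets
   [S : set Q] of elements of the ambient ring, so that ideals of different
   subrings can be compared as subsets of [Q].  In a [unitRingType],
   [GRing.unit] is exactly the set of two-sided invertible elements. *)

Section ChainConditions.
Context {X : Type}.

Definition acc (P : set X -> Prop) : Prop :=
  forall I : nat -> set X, (forall n, P (I n)) ->
    (forall n, I n `<=` I n.+1) ->
    exists n, forall m, (n <= m)%N -> I m = I n.

Definition dcc (P : set X -> Prop) : Prop :=
  forall I : nat -> set X, (forall n, P (I n)) ->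
    (forall n, I n.+1 `<=` I n) ->
    exists n, forall m, (n <= m)%N -> I m = I n.

End ChainConditions.

Section Orders.
Context {Q : unitRingType}.
Implicit Types (S I J A B P M X : set Q).

Definition subring S : Prop := GRing.subring_closed [in S].

Definition right_submodule S I : Prop :=
  GRing.zmod_closed [in I] /\ forall x s, I x -> S s -> I (x * s).

Definition left_submodule S I : Prop :=
  GRing.zmod_closed [in I] /\ forall s x, S s -> I x -> I (s * x).

Definition right_ideal S I : Prop := I `<=` S /\ right_submodule S I.

Definition left_ideal S I : Prop := I `<=` S /\ left_submodule S I.

Definition two_sided_ideal S I : Prop := right_ideal S I /\ left_ideal S I.

Definition maximal_right_ideal S M : Prop :=
  [/\ right_ideal S M, M <> S &
      forall I, right_ideal S I -> M `<=` I -> I = M \/ I = S].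

Definition maximal_left_ideal S M : Prop :=
  [/\ left_ideal S M, M <> S &
      forall I, left_ideal S I -> M `<=` I -> I = M \/ I = S].

Definition jacobson S : set Q :=
  S `&` \bigcap_(M in maximal_right_ideal S) M.

Definition local S : Prop :=
  (forall M, maximal_right_ideal S M <-> M = jacobson S) /\
  (forall M, maximal_left_ideal S M <-> M = jacobson S).

(* [P] is an additive subgroup, so it contains the ideal product [A B] as soon
   as it contains all the products [a * b]. *)
Definition prime_ideal S P : Prop :=
  [/\ two_sided_ideal S P, P <> S &
      forall A B, two_sided_ideal S A -> two_sided_ideal S B ->
        (forall a b, A a -> B b -> P (a * b)) -> A `<=` P \/ B `<=` P].

Definition prime_ring S : Prop := prime_ideal S [set 0].

Definition right_annihilator S X : set Q :=
  [set s | S s /\ forall x, X x -> x * s = 0].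

Definition left_annihilator S X : set Q :=
  [set s | S s /\ forall x, X x -> s * x = 0].

Definition independent (I : nat -> set Q) : Prop :=
  forall (n : nat) (x : nat -> Q), (forall i, I i (x i)) ->
    \sum_(i < n) x i = 0 -> forall i, (i < n)%N -> x i = 0.

Definition right_goldie S : Prop :=
  acc (fun A => exists2 X, X `<=` S & A = right_annihilator S X) /\
  ~ exists I : nat -> set Q,
      (forall n, right_ideal S (I n) /\ I n <> [set 0]) /\ independent I.

Definition left_goldie S : Prop :=
  acc (fun A => exists2 X, X `<=` S & A = left_annihilator S X) /\
  ~ exists I : nat -> set Q,
      (forall n, left_ideal S (I n) /\ I n <> [set 0]) /\ independent I.

Definition goldie S : Prop := right_goldie S /\ left_goldie S.

Definition regular S (x : Q) : Prop :=
  [/\ S x, (forall y, S y -> x * y = 0 -> y = 0) &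
      (forall y, S y -> y * x = 0 -> y = 0)].

(* The ambient ring [Q] is the two-sided classical ring of fractions of [S]. *)
Definition total_quotient_ring S : Prop :=
  [/\ (forall s, regular S s -> s \is a GRing.unit),
      (forall q, exists a s, [/\ S a, regular S s & q = a * s^-1]) &
      (forall q, exists a s, [/\ S a, regular S s & q = s^-1 * a])].

Definition is_order S : Prop :=
  [/\ subring S, prime_ring S, goldie S & total_quotient_ring S].

(* (S : I)_l and (S : J)_r *)
Definition colon_l S I : set Q := [set q | forall x, I x -> S (q * x)].

Definition colon_r S J : set Q := [set q | forall x, J x -> S (x * q)].

Definition nu S I : set Q := colon_r S (colon_l S I).

Definition right_S_ideal S I : Prop :=
  [/\ right_submodule S I, (exists x, I x /\ regular S x) &
      exists2 u, u \is a GRing.unit & forall x, I x -> S (u * x)].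

Definition right_divisorial S I : Prop := nu S I = I.

Definition right_mori S : Prop :=
  acc (fun I => [/\ right_S_ideal S I, I `<=` S & right_divisorial S I]).

End Orders.

Definition simple_ring (Q : unitRingType) : Prop :=
  forall I : set Q, two_sided_ideal setT I -> I = [set 0] \/ I = setT.

Definition artinian_ring (Q : unitRingType) : Prop :=
  dcc (@right_ideal Q setT) /\ dcc (@left_ideal Q setT).

Definition simple_artinian (Q : unitRingType) : Prop :=
  simple_ring Q /\ artinian_ring Q.

(* Main.v *)
(** Let [M] be the Jacobson radical.  It is a prime ideal of both rings, so
    [J(T) = J(S) = M], and it contains a unit [u] of [Q] by simplicity of [Q]
    and the Ore conditions.  For [R] equal to [T] or [S], locality shows that a
    right [R]-module [I] is either [aR] for a unit [a] of [Q], or satisfies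
    [(R:I)_l = (M:I)_l]: if [q i] is a unit of [R] for some [i] in [I] and
    [q] in [(R:I)_l], then [I] is principal.  Nested principal modules are
    determined by either colon, so along an ascending chain [(R:I_n)_l]
    stabilizes iff [(M:I_n)_l] does, and [R] is right Mori iff this holds for all
    chains of regular right ideals.  Finally
    [I |-> u (M:(M:I)_l)_r] turns right ideals of one ring into right ideals
    of the other, and [(M:I)_l] can be recovered from the image. *)

Require Import Defs.
From mathcomp Require Import all_boot all_order all_algebra.
From mathcomp Require Import all_classical.
Local Open Scope classical_set_scope.
Set Implicit Arguments.
Unset Strict Implicit.
Unset Printing Implicit Defensive.
Import GRing.Theory.
Local Open Scope ring_scope.

(** * Stabilization of chains of sets *)

Definition stabilizes {X : Type} (F : nat -> set X) : Prop :=
  exists n, forall m, (n <= m)%N -> F m = F n.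

Lemma chain_sub {X : Type} (F : nat -> set X) :
  (forall n, F n `<=` F n.+1) ->
  forall n m, (n <= m)%N -> F n `<=` F m.
Proof.
move=> incF n m /subnKC <-; elim: (m - n)%N => [|k IHk]; first by rewrite addn0.
by rewrite addnS; apply: subset_trans IHk (incF _).
Qed.

(** If [B] eventually fails, all late indices lie in one class. Otherwise [B] holds arbitrarily
    late, and [F m] is squeezed between two equal terms at indices in [B]. *)
Lemma chain_two_classes_stabilizes {X : Type} (F : nat -> set X)
    (B : nat -> Prop) (N : nat) :
  (forall n m, (n <= m)%N -> F m `<=` F n) ->
  (forall n m, (N <= n <= m)%N -> (B n <-> B m) -> F n = F m) ->
  stabilizes F.
Proof.
move=> decF classF.
have [[N' notB]|] := pselect (exists N', forall n, (N' <= n)%N -> ~ B n).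
  exists (maxn N N') => m; rewrite geq_max => /andP[Nm N'm].
  have [m_le|/ltnW m_ge] := leqP m (maxn N N').
    by congr F; apply/eqP; rewrite eqn_leq m_le geq_max Nm N'm.
  apply/esym/classF; first by rewrite leq_maxl.
  by split=> [/notB|/(notB _ N'm)] //; case; rewrite leq_maxr.
move=> often; have nextB n : exists2 m, (n <= m)%N & B m.
  apply: contrapT => none; apply: often; exists n => m nm Bm.
  by apply: none; exists m.
have [n0 Nn0 Bn0] := nextB N; exists n0 => m n0m.
have [m' mm' Bm'] := nextB m.
rewrite eqEsubset; split; first exact: decF.
rewrite (classF n0 m') ?Nn0 ?(leq_trans n0m) //.
exact: decF.
Qed.

Section LocalOrders.
Context {Q : unitRingType}.
Implicit Types (R S T M I J K X : set Q).

(** * Subrings, one-sided ideals and local rings *)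

Lemma zmod_closed_setE I :
  GRing.zmod_closed [in I] <-> I 0 /\ forall x y, I x -> I y -> I (x - y).
Proof.
split=> [[I0 IB]|[I0 IB]].
  by split=> [|x y Ix Iy]; apply: set_mem; [exact: I0|apply: IB; exact: mem_set].
split; first exact: mem_set.
by move=> x y /set_mem Ix /set_mem Iy; apply/mem_set/IB.
Qed.

Lemma subring1 R : subring R -> R 1.
Proof. by case=> R1 _ _; exact: set_mem. Qed.

Lemma subringB R x y : subring R -> R x -> R y -> R (x - y).
Proof. by case=> _ RB _ Rx Ry; apply/set_mem/RB; exact: mem_set. Qed.

Lemma subringM R x y : subring R -> R x -> R y -> R (x * y).
Proof. by case=> _ _ RM Rx Ry; apply/set_mem/RM; exact: mem_set. Qed.

Lemma subring0 R : subring R -> R 0.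
Proof. by move=> RR; rewrite -(subrr 1); apply: subringB => //; exact: subring1. Qed.

Lemma right_ideal1 R I : right_ideal R I -> I 1 -> I = R.
Proof.
move=> [IR [_ IM]] I1; rewrite eqEsubset; split=> // x Rx.
by rewrite -(mul1r x); exact: IM.
Qed.

(** The right ideals [y ^+ n * Q] stabilize, so [y ^+ n = y ^+ n.+1 * r]. Cancelling [y ^+ n] by
    [x ^+ n] gives [y] a right inverse [r], which must equal its left inverse [x]. *)
Lemma artinian_dedekind_finite (x y : Q) :
  artinian_ring Q -> x * y = 1 -> y * x = 1.
Proof.
move=> [dccQ _] xy1.
have xyn n : x ^+ n * y ^+ n = 1.
  elim: n => [|n IHn]; first by rewrite mulr1.
  by rewrite exprSr exprS mulrA -(mulrA _ x) xy1 mulr1.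
have [||n] := dccQ (fun n => [set q | exists r, q = y ^+ n * r]).
- move=> n; split=> //; split.
    apply/zmod_closed_setE; split; first by exists 0; rewrite mulr0.
    by move=> _ _ [r ->] [s ->]; exists (r - s); rewrite mulrBr.
  by move=> _ s [r ->] _; exists (r * s); rewrite mulrA.
- by move=> n _ [r ->]; exists (y * r); rewrite exprSr mulrA.
move=> /(_ n.+1 (leqnSn n)) stab.
have [r yr] : [set q | exists r, q = y ^+ n.+1 * r] (y ^+ n).
  by rewrite stab; exists 1; rewrite mulr1.
have yr1 : y * r = 1.
  by rewrite -[LHS]mul1r -(xyn n) -!mulrA (mulrA _ y) -exprSr -yr.
suff -> : x = r by [].
by rewrite -[x]mulr1 -yr1 mulrA xy1 mul1r.
Qed.

Lemma sub_maximal_right_ideal R J :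
  right_ideal R J -> ~ J 1 -> R 1 ->
  exists2 M, maximal_right_ideal R M & J `<=` M.
Proof.
move=> RJ J1 R1.
(* Joining [J] to each candidate makes Zorn's lemma apply to the empty chain too, whose union alone
   is not an ideal. *)
pose P X := right_ideal R (J `|` X) /\ ~ (J `|` X) 1.
have [F FP totF|A [[RA A1] maxA]] := @Zorn_bigcup Q P.
  split; last by case=> // -[X FX X1]; have [_] := FP X FX; apply; right.
  have [JR [/zmod_closed_setE[J0 JB] JM]] := RJ.
  split.
    by move=> x [/JR //|[X FX Xx]]; have [[XR _] _] := FP X FX; apply: XR; right.
  split; last first.
    move=> x s [Jx|[X FX Xx]] Rs; first by left; exact: JM.
    have [[_ [_ XM]] _] := FP X FX.
    by have [|Jxs|Xxs] := XM x s _ Rs; [right|left|right; exists X].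
  apply/zmod_closed_setE; split; first by left.
  have closed X x y : F X -> (J `|` X) x -> (J `|` X) y ->
      (J `|` \bigcup_(Y in F) Y) (x - y).
    move=> FX Xx Xy; have [[_ [/zmod_closed_setE[_ XB] _]] _] := FP X FX.
    by have [Jxy|Xxy] := XB _ _ Xx Xy; [left|right; exists X].
  move=> x y [Jx|[X FX Xx]] [Jy|[Y FY Yy]].
  - by left; exact: JB.
  - by apply: (closed Y) => //; [left|right].
  - by apply: (closed X) => //; [right|left].
  have [XY|YX] := totF _ _ FX FY.
    by apply: (closed Y) => //; right=> //; exact: XY.
  by apply: (closed X) => //; right=> //; exact: YX.
exists (J `|` A); last by move=> x; left.
split=> // [AR|I RI AI]; first by apply: A1; rewrite AR.
have [I1|I1] := pselect (I 1); first by right; exact: right_ideal1.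
have JI : J `|` I = I by apply/setUidPr => x Jx; apply: AI; left.
left; rewrite eqEsubset; split=> // x Ix; apply: contrapT => nAx.
apply: (maxA I); last by rewrite /P JI.
by split=> [y Ay|IA]; [apply: AI|apply: nAx]; right=> //; exact: IA.
Qed.

(* As the units are taken in the ambient ring [Q], this describes a
   local ring [R] with maximal ideal [M] without mentioning maximality. *)
Definition local_with R M : Prop :=
  [/\ subring R, two_sided_ideal R M, ~ M 1 &
      forall x, R x -> ~ M x -> x \is a GRing.unit /\ R x^-1].

(** If [x * R] is proper, it lies in a maximal right ideal, hence in the radical. Otherwise [x] has
    a right inverse in [R], two-sided because [Q] is Dedekind-finite. *)
Lemma local_with_jacobson R :
  artinian_ring Q -> subring R -> local R -> local_with R (jacobson R).
Proof.
move=> artQ RR [locr locl].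
have [RJ JR maxJ] := (locr _).2 erefl.
have [LJ _ _] := (locl _).2 erefl.
split=> // [J1|x Rx nJx]; first exact/JR/right_ideal1.
pose I := [set q | exists2 r, R r & q = x * r].
have Ix : I x by exists 1; rewrite ?mulr1//; exact: subring1.
have RI : right_ideal R I.
  split; first by move=> _ [r Rr ->]; exact: subringM.
  split; last first.
    by move=> _ s [r Rr ->] Rs; exists (r * s); rewrite ?mulrA//; exact: subringM.
  apply/zmod_closed_setE; split; first by exists 0; rewrite ?mulr0//; exact: subring0.
  by move=> _ _ [r Rr ->] [s Rs ->]; exists (r - s); rewrite ?mulrBr//; exact: subringB.
have [[r Rr xr1]|nI1] := pselect (I 1).
  have rx1 := artinian_dedekind_finite artQ (esym xr1).
  have ux : x \is a GRing.unit by apply/unitrP; exists r.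
  split=> //; suff -> : x^-1 = r by [].
  by rewrite -[LHS]mulr1 xr1 mulKr.
have [N /locr -> IJ] := sub_maximal_right_ideal RI nI1 (subring1 RR).
by case: nJx; exact: IJ.
Qed.

(** An element [a] of [A] outside [M] is a unit of [R], so each [b] in [B] equals [a^-1 * (a * b)]
    and lies in [M]. *)
Lemma local_with_prime R M : local_with R M -> prime_ideal R M.
Proof.
move=> [RR MM nM1 uM]; split=> //.
  by move=> MR; apply: nM1; rewrite MR; exact: subring1.
move=> A B [[AR _] _] [[BR _] _] ABM.
have [|nAM] := pselect (A `<=` M); [by left|right=> b Bb].
have [a Aa nMa] : exists2 a, A a & ~ M a.
  apply: contrapT => none; apply: nAM => a Aa; apply: contrapT => nMa.
  by apply: none; exists a.
have [ua Ra] := uM a (AR a Aa) nMa.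
have [_ [_ [_ LM]]] := MM.
by rewrite -(mulKr ua b); apply: LM => //; exact: ABM.
Qed.

Lemma prime_sub_local R M P : local_with R M -> prime_ideal R P -> P `<=` M.
Proof.
move=> [RR MM nM1 uM] [[[PR [PB PM]] _] nPR _] x Px.
apply: contrapT => nMx; have [ux Rx] := uM x (PR x Px) nMx.
by apply/nPR/right_ideal1; [split|rewrite -(mulrV ux); exact: PM].
Qed.

(** Denominators are nonzero, hence already invertible in [R]. This serves to rule out a zero
    radical. *)
Lemma local_zero_total R :
  local_with R [set 0] -> total_quotient_ring R -> R = setT.
Proof.
move=> [RR _ _ uR] [regR fracR _]; rewrite eqEsubset; split=> // q _.
have [a [s [Ra regs ->]]] := fracR q.
apply: subringM => //; apply: (proj2 (uR s _ _)); first by case: regs.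
by move=> s0; have := regR s regs; rewrite s0 unitr0.
Qed.

(** * Units of [Q] inside ideals of an order *)

Lemma regular_unit R x : total_quotient_ring R ->
  regular R x <-> R x /\ x \is a GRing.unit.
Proof.
move=> [regR _ _]; split=> [regx|[Rx ux]]; first by split; [case: regx|exact: regR].
split=> // y _ xy0; first by rewrite -(mulKr ux y) xy0 mulr0.
by rewrite -(mulrK ux y) xy0 mul0r.
Qed.

(* By the Ore conditions the [q] with [s q t] in [M] for some regular [s] and
   [t] form a nonzero ideal of [Q], so [1] is among them. *)
Lemma ideal_has_unit R M :
  simple_ring Q -> subring R -> total_quotient_ring R -> two_sided_ideal R M ->
  M <> [set 0] -> exists2 u, M u & u \is a GRing.unit.
Proof.
move=> simQ RR QR [[MR [/zmod_closed_setE[M0 MB] rM]] [_ [_ lM]]] nM0.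
have regE := fun x => regular_unit x QR.
have [_ fracr fracl] := QR.
pose U := [set s | R s /\ s \is a GRing.unit].
have U1 : U 1 by split; [exact: subring1|exact: unitr1].
have UU s t : U s -> U t -> U (s * t).
  by move=> [Rs us] [Rt ut]; split; [exact: subringM|rewrite unitrMl].
pose D := [set q | exists s t, [/\ U s, U t & M (s * q * t)]].
have Dl p q : D q -> D (p * q).
  (* Writing [p / s] as a left fraction gives [c * p = b * s], so [c] can replace [s] as left
     multiplier. *)
  move=> [s [t [Us Ut Mq]]]; have [b [c [Rb /regE Uc pE]]] := fracl (p * s^-1).
  exists c, t; split=> //.
  suff -> : c * (p * q) * t = b * (s * q * t) by apply: lM.
  have [[_ us] [_ uc]] := (Us, Uc).
  have cp : c * p = b * s by rewrite -(divrK us p) pE !mulrA mulrV// mul1r.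
  by rewrite !mulrA cp.
have Dr p q : D q -> D (q * p).
  move=> [s [t [Us Ut Mq]]]; have [b [c [Rb /regE Uc pE]]] := fracr (t^-1 * p).
  exists s, c; split=> //.
  suff -> : s * (q * p) * c = s * q * t * b by apply: rM.
  have [[_ ut] [_ uc]] := (Ut, Uc).
  have pc : p * c = t * b by rewrite -(mulVKr ut p) pE mulrA divrK.
  by rewrite -!mulrA pc.
have DB p q : D p -> D q -> D (p - q).
  move=> [s1 [t1 [Us1 Ut1 Mp]]] [s2 [t2 [Us2 Ut2 Mq]]].
  have [[Rs1 us1] [Rt1 ut1]] := (Us1, Ut1).
  have [[Rs2 us2] [Rt2 ut2]] := (Us2, Ut2).
  (* Common multiples [c * s2 = b * s1] and [t2 * e = t1 * d] serve [p] and [q] simultaneously. *)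
  have [b [c [Rb /regE[Rc uc] sE]]] := fracl (s2 * s1^-1).
  have [d [e [Rd /regE[Re ue] tE]]] := fracr (t1^-1 * t2).
  have cs : c * s2 = b * s1.
    by rewrite -(divrK us1 s2) sE !mulrA mulrV// mul1r.
  have te : t2 * e = t1 * d by rewrite -(mulVKr ut1 t2) tE mulrA divrK.
  exists (c * s2), (t2 * e); split; [exact: UU|exact: UU|].
  rewrite mulrBr mulrBl; apply: MB.
    rewrite cs te; have -> : b * s1 * p * (t1 * d) = b * (s1 * p * t1) * d.
      by rewrite !mulrA.
    by apply: rM => //; exact: lM.
  have -> : c * s2 * q * (t2 * e) = c * (s2 * q * t2) * e by rewrite !mulrA.
  by apply: rM => //; exact: lM.
have MD : M `<=` D by move=> m Mm; exists 1, 1; split; rewrite ?mulr1 ?mul1r.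
have zD : GRing.zmod_closed [in D].
  by apply/zmod_closed_setE; split=> //; exact: MD.
have DD : two_sided_ideal setT D.
  split; split=> //; split=> //; first by move=> x s Dx _; exact: Dr.
  by move=> s x _ Dx; exact: Dl.
have [D0|DT] := simQ D DD.
  by case: nM0; rewrite eqEsubset; split=> [m /MD|_ ->//]; rewrite D0.
have [s [t [Us Ut]]] : D 1 by rewrite DT.
rewrite mulr1 => Mst; exists (s * t) => //.
by have [] := UU _ _ Us Ut.
Qed.

(** * Colons and the closure [nu] *)

Lemma colon_l_anti S I J : I `<=` J -> colon_l S J `<=` colon_l S I.
Proof. by move=> IJ q qJ x /IJ; exact: qJ. Qed.

Lemma sub_nu S I : I `<=` nu S I.
Proof. by move=> x Ix q; exact. Qed.

Lemma colon_l_nu S I : colon_l S (nu S I) = colon_l S I.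
Proof.
rewrite eqEsubset; split; first by apply: colon_l_anti; exact: sub_nu.
by move=> q qI x; exact.
Qed.

Lemma nu_le S I J : I `<=` J -> nu S I `<=` nu S J.
Proof. by move=> IJ x xI q /(colon_l_anti IJ); exact: xI. Qed.

(** The module structure comes from [M] alone, whatever [I] is; this is what allows a change of
    ring. *)
Lemma right_submodule_nu R M I : right_submodule R M -> right_submodule R (nu M I).
Proof.
move=> [/zmod_closed_setE[M0 MB] MM]; split.
  apply/zmod_closed_setE; split=> [q _|x y xI yI q qI]; first by rewrite mulr0.
  by rewrite mulrBr; apply: MB; [exact: xI|exact: yI].
by move=> x s xI Rs q qI; rewrite mulrA; apply: MM => //; exact: xI.
Qed.

Definition lscale (u : Q) I : set Q := [set x | exists2 y, I y & x = u * y].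

Lemma right_submodule_lscale R u I :
  right_submodule R I -> right_submodule R (lscale u I).
Proof.
move=> [/zmod_closed_setE[I0 IB] IM]; split.
  apply/zmod_closed_setE; split; first by exists 0; rewrite ?mulr0.
  by move=> _ _ [x Ix ->] [y Iy ->]; exists (x - y); rewrite ?mulrBr//; exact: IB.
by move=> _ s [x Ix ->] Rs; exists (x * s); rewrite ?mulrA//; exact: IM.
Qed.

Lemma colon_l_lscale S u I q :
  u \is a GRing.unit -> colon_l S I q <-> colon_l S (lscale u I) (q / u).
Proof.
move=> uu; split=> [qI _ [x Ix ->]|qI x Ix]; first by rewrite mulrA divrK//; exact: qI.
by rewrite -(divrK uu q) -mulrA; apply: qI; exists x.
Qed.

(** * Principal modules and stabilization of colons *)

Definition principal R I : Prop :=
  exists2 a, a \is a GRing.unit & I = lscale a R.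

(** The goal reduces to [a^-1 * b] lying in [R]. Colons into [R] give this from [a^-1]. For colons
    into [M], write [a = b * t]: if [t] were in [M], then [b^-1] would send [b] into [M], so [t] is
    a unit of [R]. *)
Lemma principal_eq R M I J : local_with R M -> principal R I -> principal R J ->
  I `<=` J -> colon_l R I = colon_l R J \/ colon_l M I = colon_l M J -> I = J.
Proof.
move=> [RR [[_ [_ rM]] _] nM1 uM] [a ua ->] [b ub ->] IJ eqc.
rewrite eqEsubset; split=> // _ [y Ry ->].
suff Rab : R (a^-1 * b).
  by exists (a^-1 * b * y); [exact: subringM|rewrite !mulrA mulrV// mul1r].
have bR : lscale b R b by exists 1; rewrite ?mulr1//; exact: subring1.
case: eqc => eqc.
  suff : colon_l R (lscale b R) a^-1 by apply.
  by rewrite -eqc => _ [x Rx ->]; rewrite mulKr.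
have [t Rt aE] : lscale b R a.
  by apply: IJ; exists 1; rewrite ?mulr1//; exact: subring1.
have [Mt|nMt] := pselect (M t); last first.
  have [ut Rt'] := uM t Rt nMt.
  suff -> : a^-1 * b = t^-1 by [].
  by rewrite aE invrM// -mulrA mulVr// mulr1.
case: nM1; rewrite -(mulVr ub).
suff : colon_l M (lscale b R) b^-1 by apply.
by rewrite -eqc => _ [x Rx ->]; rewrite aE -mulrA mulKr//; exact: rM.
Qed.

Lemma colon_l_not_principal R M I :
  artinian_ring Q -> local_with R M -> right_submodule R I -> ~ principal R I ->
  colon_l R I = colon_l M I.
Proof.
move=> artQ [RR [[MR _] _] nM1 uM] [_ IM] nprinc.
rewrite eqEsubset; split=> q qI x Ix; last exact/MR/qI.
(* A value [t = q * x] outside [M] is a unit of [R]; then [x / t] is inverse to [q] and generates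
   [I]. *)
apply: contrapT => nMqx; have [ut Rt] := uM _ (qI x Ix) nMqx.
apply: nprinc; set t := q * x in ut Rt.
have qx1 : q * (x / t) = 1 by rewrite mulrA mulrV.
have xq1 := artinian_dedekind_finite artQ qx1.
exists (x / t); first by apply/unitrP; exists q.
rewrite eqEsubset; split=> [y Iy|_ [r Rr ->]].
  by exists (q * y); [exact: qI|rewrite mulrA xq1 mul1r].
by rewrite -mulrA; apply: IM => //; exact: subringM.
Qed.

(** The two classes of indices are those with [I n] principal and the rest: on the first a colon
    determines the module, on the second both colons coincide. *)
Lemma stabilizes_colon R M (I : nat -> set Q) :
  artinian_ring Q -> local_with R M -> (forall n, right_submodule R (I n)) ->
  (forall n, I n `<=` I n.+1) ->
  stabilizes (fun n => colon_l R (I n)) <-> stabilizes (fun n => colon_l M (I n)).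
Proof.
move=> artQ locR modI /chain_sub incI.
have transfer A B :
    (forall n, ~ principal R (I n) -> colon_l A (I n) = colon_l B (I n)) ->
    (forall n m, (n <= m)%N -> principal R (I n) -> principal R (I m) ->
      colon_l A (I n) = colon_l A (I m) -> I n = I m) ->
    stabilizes (fun n => colon_l A (I n)) -> stabilizes (fun n => colon_l B (I n)).
  move=> eqAB eqI [N stabA].
  apply: (@chain_two_classes_stabilizes _ _ (fun n => principal R (I n)) N).
    by move=> n m /incI; exact: colon_l_anti.
  move=> n m /andP[Nn nm] princE.
  have eqA : colon_l A (I n) = colon_l A (I m) by rewrite !stabA// (leq_trans Nn).
  have [pn|npn] := pselect (principal R (I n)).
    by congr colon_l; apply: eqI => //; apply/princE.
  by rewrite -!eqAB// => /princE.
split; apply: transfer => n.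
- exact: colon_l_not_principal.
- by move=> m nm pn pm eqR; apply: (principal_eq locR) => //; [exact: incI|left].
- by move=> npn; rewrite (colon_l_not_principal artQ locR).
- by move=> m nm pn pm eqM; apply: (principal_eq locR) => //; [exact: incI|right].
Qed.

(** * The Mori condition and its transfer *)

(** Closing [I n] under [nu] makes it divisorial without changing its colon, and a divisorial ideal
    is recovered from its colon. *)
Lemma right_mori_colonP R : subring R -> total_quotient_ring R ->
  right_mori R <->
  forall I : nat -> set Q,
    (forall n, right_ideal R (I n)) ->
    (forall n, exists2 x, I n x & x \is a GRing.unit) ->
    (forall n, I n `<=` I n.+1) -> stabilizes (fun n => colon_l R (I n)).
Proof.
move=> RR QR; split=> [moriR I RI uI incI|stabR I propI incI].
  have nuR n : nu R (I n) `<=` R.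
    move=> x nux; rewrite -(mul1r x); apply: nux => y Iy.
    by rewrite mul1r; apply: (proj1 (RI n)).
  have modR : right_submodule R R.
    split; last by move=> x s; exact: subringM.
    by apply/zmod_closed_setE; split; [exact: subring0|move=> x y; exact: subringB].
  have [n|n|N stab] := moriR (fun n => nu R (I n)); last 1 first.
  - by exists N => m Nm; rewrite -colon_l_nu stab// colon_l_nu.
  - split=> //; last by rewrite /right_divisorial {1}/nu colon_l_nu.
    split; first exact: right_submodule_nu.
      have [x Ix ux] := uI n; exists x; split; first exact: sub_nu.
      by apply/regular_unit => //; split=> //; apply: (proj1 (RI n)).
    by exists 1 => [|x /nuR]; rewrite ?unitr1// mul1r.
  - exact: nu_le.
have [n|n|//|N stab] := stabR I.
- by have [[modI _ _] IR _] := propI n.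
- have [[_ [x [Ix /(regular_unit _ QR)[_ ux]]] _] _ _] := propI n.
  by exists x.
exists N => m Nm; have [[_ _ <-] [_ _ <-]] := (propI m, propI N).
by rewrite /nu stab.
Qed.

Lemma right_mori_transfer R S M :
  artinian_ring Q -> local_with R M -> local_with S M ->
  total_quotient_ring R -> total_quotient_ring S ->
  (exists2 u, M u & u \is a GRing.unit) ->
  right_mori R -> right_mori S.
Proof.
move=> artQ locR locS QR QS [u Mu uu].
have [[RR [[MR modRM] _] _ _] [SS [[_ [_ rSM]] _] _ _]] := (locR, locS).
move=> /(right_mori_colonP RR QR) stabR.
apply/(right_mori_colonP SS QS) => I SI uI incI.
have modI n : right_submodule S (I n) by case: (SI n).
apply/(stabilizes_colon artQ locS modI incI).
(* As [u] is in [M] and [I n] in [S], [u] belongs to the colon of [I n] into [M]; hence [K n] lies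
   in [M], so in [R]. *)
pose K n := lscale u (nu M (I n)).
have modK n : right_submodule R (K n).
  exact/right_submodule_lscale/right_submodule_nu.
have incK n : K n `<=` K n.+1.
  by move=> _ [y Iy ->]; exists y => //; exact: nu_le Iy.
have KR n : K n `<=` R.
  move=> _ [y nuy ->]; apply/MR/nuy => x Ix.
  by apply: rSM => //; apply: (proj1 (SI n)).
have uK n : exists2 x, K n x & x \is a GRing.unit.
  have [x Ix ux] := uI n; exists (u * x); last by rewrite unitrMl.
  by exists x => //; exact: sub_nu.
have [N stabK] : stabilizes (fun n => colon_l M (K n)).
  by apply/(stabilizes_colon artQ locR modK incK); apply: stabR.
(* Since [u] is a unit, the colon of [I n] is that of [K n] multiplied on the right by [u]. *)
have KE n q : colon_l M (I n) q <-> colon_l M (K n) (q / u).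
  by rewrite -colon_l_nu; exact: colon_l_lscale.
exists N => m Nm; rewrite eqEsubset.
by split=> q /KE qK; apply/KE; move: qK; rewrite stabK.
Qed.

End LocalOrders.

Theorem theorem3p5 (Q : unitRingType) (T S : set Q)
    (hQ : simple_artinian Q)
    (hT : is_order T) (hS : is_order S)
    (localT : local T) (localS : local S)
    (hTS : T `<` S)
    (same_primes : [set P | prime_ideal T P] = [set P | prime_ideal S P]) :
  right_mori T <-> right_mori S.
Proof.
have [simQ artQ] := hQ.
have [[TT _ _ QT] [SS _ _ QS]] := (hT, hS).
have locT := local_with_jacobson artQ TT localT.
have locS := local_with_jacobson artQ SS localS.
have primeE P : prime_ideal T P <-> prime_ideal S P.
  by have /(congr1 (@^~ P)) /= -> := same_primes.
(* Each radical is a prime ideal of its own ring, hence of the other, whose radical contains all its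
   primes. *)
have JE : jacobson T = jacobson S.
  rewrite eqEsubset; split.
    exact/(prime_sub_local locS)/primeE/local_with_prime.
  exact/(prime_sub_local locT)/primeE/local_with_prime.
rewrite -JE in locS; set M := jacobson T in locT locS.
have unitM : exists2 u, M u & u \is a GRing.unit.
  have [_ MM _ _] := locT.
  (* A zero radical would force [T = Q], leaving no room for a strictly larger [S]. *)
  apply: (ideal_has_unit simQ TT QT MM) => M0; rewrite M0 in locT.
  by case: hTS => _; apply; rewrite (local_zero_total locT QT).
by split; apply: (@right_mori_transfer _ _ _ M).
Qed.
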